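(* Let $B$ and $W_m$, $m\ge1$, be stochastic processes on a probability space $(\Omega,\mathcal F,\Pr)$ such that: (a) for a simple symmetric random walk $S=\{S(k):k=0,1,\dots\}$ and for each $m\ge1$, the sequences $\{W_m(k2^{-2m}):k=0,1,\dots\}$ and $\{2^{-m}S(k):k=0,1,\dots\}$ have the same finite-dimensional distributions; (b) for each $m\ge1$ there is a random partition $\{T_{m+1}(k):k\ge1\}$ of $[0,\infty)$ such that $W_{m+1}(T_{m+1}(k))=W_m(k2^{-2m})$ for each $k\ge1$; (c) $B$ is a standard Brownian motion, and for each $T>0$, $\sup_{0\le t\le T}|B(t)-\widehat W_m(t)|\to0$ almost surely as $m\to\infty$, where $\widehat W_m$ is the process indexed by $t\in[0,\infty)$ obtained from $W_m$ by linear interpolation; (d) with probability $1$, for any $T'>T>0$ and for all but finitely many $m$ there exists a random partition $\{\tau_m(k):0\le k\le T2^{2m}\}$ of $[0,T')$ such that $B(\tau_m(k))=W_m(k2^{-2m})$ for $0\le k\le T2^{2m}$, where $\max_k|\tau_m(k)-\tau_m(k-1)|\to0$ and $\max_k|\tau_m(k)-k2^{-2m}|\to0$ as $m\to\infty$. Let $0<T<\infty$. Then with probability $1$, for each $0\le t\le T$, $$\lim_{m\to\infty}\prod_{k=1}^{[t2^{2m}]}\big[1+W_m(k2^{-2m})-W_m((k-1)2^{-2m})\big]=\exp\{B(t)-t/2\}.$$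
   Context: A simple symmetric random walk is $S(0)=0$, $S(k)=r_1+\dots+r_k$ with $r_1,r_2,\dots$ independent and $\Pr(r_i=1)=\Pr(r_i=-1)=1/2$. $[x]$ denotes the integer part of $x$. A random partition is a nondecreasing random sequence of points, starting at $0$, of the indicated interval (increasing to $\infty$ in the case of $[0,\infty)$). *)

(* Defs.v *)
From HB Require Import structures.
From mathcomp Require Import all_boot all_order all_algebra.
From mathcomp Require Import all_classical all_reals all_analysis.
Set Implicit Arguments.
Unset Strict Implicit.
Unset Printing Implicit Defensive.
Import Order.TTheory GRing.Theory Num.Theory.
Import numFieldNormedType.Exports.
Local Open Scope classical_set_scope.
Local Open Scope ring_scope.

Definition mutually_independent (R : realType) (d : measure_display)
    (Omega : measurableType d) (P : probability Omega R)
    (I : eqType) (X : I -> Omega -> R) : Prop :=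
  forall (J : seq I) (A : I -> set R), uniq J -> (forall i, measurable (A i)) ->
    P (\bigcap_(i in [set` J]) (X i @^-1` A i)) =
    (\prod_(i <- J) P (X i @^-1` A i))%E.

(* The step r_k is [r k.-1]: the sequence r_1, r_2, ... is indexed from 0. *)
Definition simple_symmetric_random_walk (R : realType) (d : measure_display)
    (Omega : measurableType d) (P : probability Omega R)
    (S : nat -> {RV P >-> R}) : Prop :=
  exists r : nat -> {RV P >-> R},
    [/\ mutually_independent P (fun i => r i : Omega -> R),
        forall i, P (r i @^-1` [set 1]) = (2^-1)%:E /\
                  P (r i @^-1` [set -1]) = (2^-1)%:E
      & forall k w, S k w = \sum_(i < k) r i w].

(* Equality of the joint laws of (X_{i_1}, ..., X_{i_n}) and
   (Y_{i_1}, ..., Y_{i_n}) on the product sigma-algebra of R^n; the two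
   families may live on different probability spaces. *)
Definition same_fdd (R : realType) (d d' : measure_display)
    (Omega : measurableType d) (Omega' : measurableType d')
    (P : probability Omega R) (P' : probability Omega' R)
    (I : Type) (X : I -> Omega -> R) (Y : I -> Omega' -> R) : Prop :=
  forall (n : nat) (i : 'I_n -> I) (A : set (n.-tuple R)), measurable A ->
    P ((fun w => [tuple X (i j) w | j < n]) @^-1` A) =
    P' ((fun w => [tuple Y (i j) w | j < n]) @^-1` A).

(* Processes indexed by [0, +oo) are families over R; their values at negative
   times are never used.  Every finite chain t_0 <= ... <= t_n extends to an
   infinite nondecreasing sequence, so independence of the increments along
   such sequences is the usual one.  The second parameter of [normal_prob] is
   the standard deviation. *)
Definition standard_brownian_motion (R : realType) (d : measure_display)
    (Omega : measurableType d) (P : probability Omega R)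
    (B : R -> {RV P >-> R}) : Prop :=
  [/\ {ae P, forall w, B 0 w = 0},
      forall t : nat -> R, 0 <= t 0%N ->
        (forall i j, (i <= j)%N -> t i <= t j) ->
        mutually_independent P (fun i w => B (t i.+1) w - B (t i) w),
      forall s t : R, 0 <= s -> s < t -> forall A : set R, measurable A ->
        P ((fun w => B t w - B s w) @^-1` A) =
        normal_prob 0 (Num.sqrt (t - s)) A
    & {ae P, forall w, {within `[0, +oo[, continuous (fun t => B t w)}}].

Definition grid (R : realType) (m k : nat) : R := k%:R / 2 ^+ (2 * m).

(* The integer part [t 2^{2m}], for t >= 0. *)
Definition nsteps (R : realType) (m : nat) (t : R) : nat :=
  Num.truncn (t * 2 ^+ (2 * m)).

(* Linear interpolation, at t >= 0, of the values of x at the points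
   k 2^{-2m}. *)
Definition interpolate (R : realType) (m : nat) (x : R -> R) (t : R) : R :=
  let k := nsteps m t in
  x (grid R m k) + (t * 2 ^+ (2 * m) - k%:R) *
                   (x (grid R m k.+1) - x (grid R m k)).

(* A (path of a) partition of [0, +oo): the points are indexed by all k >= 0,
   the 0-th one being the starting point 0. *)
Definition partition_halfline (R : realType) (p : nat -> R) : Prop :=
  [/\ p 0%N = 0, forall k, p k <= p k.+1 & p k @[k --> \oo] --> +oo].

(* A (path of a) partition p 0, ..., p n of [0, b); the values of p beyond n
   are irrelevant. *)
Definition partition_upto (R : realType) (b : R) (n : nat) (p : nat -> R)
    : Prop :=
  [/\ p 0%N = 0, forall k, (k < n)%N -> p k <= p k.+1
    & forall k, (k <= n)%N -> p k \in `[0, b[].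

(* Main.v *)
Require Import Defs.
From HB Require Import structures.
From mathcomp Require Import all_boot all_order all_algebra.
From mathcomp Require Import all_classical all_reals all_analysis.
From mathcomp Require Import measurable_realfun.
From mathcomp Require Import ring lra.
Set Implicit Arguments.
Unset Strict Implicit.
Unset Printing Implicit Defensive.
Import Order.TTheory GRing.Theory Num.Theory.
Import numFieldNormedType.Exports.
Local Open Scope classical_set_scope.
Local Open Scope ring_scope.

(** A product of factors [1 + x] with [x = h] or [x = - h] needs no Taylor
    expansion: [ln (1 + x)] takes only two values, so it is an affine function
    of [x],
      [ln (1 + x) = ln (1 - h ^ 2) / 2 + x (ln (1 + h) - ln (1 - h)) / (2 h)].
    Summing along a path [c] that starts at [0] and moves by [h] up or down,
    the product of its first [n] factors is the exponential of an expression
    in [n] and [c n] alone ([prod_pm_steps]):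
      [n h ^ 2 * (ln (1 - h ^ 2) / h ^ 2) / 2 +
       c n * (ln (1 + h) / h + ln (1 - h) / (- h)) / 2].
    As [h] tends to [0], the derivative of [ln] at [1] makes the factor of
    [n h ^ 2 / 2] tend to [- 1] and that of [c n / 2] tend to [2]; the exponent
    thus tends to [b - t / 2] as soon as [n h ^ 2] tends to [t] and [c n] tends
    to [b] ([cvg_prod_pm_steps]).

    Here [h = 2 ^- m] and [n] is the integer part of [t 2 ^ (2 m)], so that
    [n h ^ 2] tends to [t].  Equality in law with the scaled walk makes [W m]
    almost surely such a path on its grid, for all [m] at once since there are
    countably many steps ([scaled_walk_step]).  The uniform convergence of the
    interpolated paths to [B] gives [W m (n 2 ^- (2 m)) --> B t]: passing from
    the interpolated path at [t] to its value at the last grid point costs at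
    most one step ([dist_interpolate]).  None of the exceptional null sets
    depends on [t], hence the limit holds simultaneously for all [t] between
    [0] and [T]. *)

(** This is the derivative of [ln] at [1], along a sequence of increments. *)
Lemma cvg_ln1D_div (R : realType) (u : R^nat) :
  u @ \oo --> 0 -> (forall m, u m != 0) ->
  ln (1 + u m) / u m @[m --> \oo] --> (1 : R).
Proof.
move=> u0 un0.
have [dln Dln] := is_derive1_ln (@ltr01 R).
have /cvg_ex[l Hl] := dln.
have l1 : l = 1 by move: Dln; rewrite /derive (cvg_lim _ Hl)// invr1.
have u0' : u @ \oo --> 0^'.
  move=> A A0; have : \forall m \near \oo, u m != 0 -> A (u m) := u0 _ A0.
  by apply: filterS => m; apply; exact: un0.
have := cvg_comp _ _ u0' Hl; rewrite l1; apply: cvg_trans.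
apply: near_eq_cvg; near=> m => /=.
by rewrite ln1 subr0 [in RHS]mulrC scaler1 addrC.
Unshelve. all: by end_near. Qed.

(** The logarithm restricted to [{1 - h, 1 + h}] is affine, so the logarithm of
    the product depends on the path only through its endpoint.  The quotients
    [ln (1 + u) / u] are kept apart because they are what tends to [1]. *)
Lemma prod_pm_steps (R : realType) (h : R) (c : nat -> R) (n : nat) :
  0 < h < 1 -> c 0%N = 0 -> (forall k, `|c k.+1 - c k| = h) ->
  \prod_(1 <= k < n.+1) (1 + c k - c k.-1) =
  expR (- (n%:R * h ^+ 2 * (ln (1 - h ^+ 2) / - h ^+ 2)) / 2 +
        c n * ((ln (1 + h) / h + ln (1 - h) / - h) / 2)).
Proof.
move=> /andP[h0 h1] c0 ch.
have hn0 : h != 0 by rewrite gt_eqF.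
have -> : ln (1 - h ^+ 2) = ln (1 + h) + ln (1 - h).
  by rewrite -lnM ?posrE; [congr ln; ring|lra|lra].
elim: n => [|n IHn].
  by rewrite big_geq// c0 !mul0r oppr0 mul0r addr0 expR0.
rewrite big_nat_recr//= {}IHn.
have [x cx] : {x | c n.+1 = c n + x}
  by exists (c n.+1 - c n); rewrite addrC subrK.
have := ch n; rewrite cx addrAC subrr add0r => absx.
rewrite (_ : 1 + (c n + x) - c n = 1 + x); last by ring.
have : x = h \/ x = - h.
  by move/eqP: absx; rewrite eqr_norml ltW// andbT => /orP[] /eqP; [left|right].
by case=> ->; rewrite -[X in _ * X]lnK ?posrE; try lra;
  rewrite -expRD -natr1; congr expR; field.
Qed.

(** Deterministic core of the result: only the number of steps, in units of
    [h ^- 2], and the endpoint of the path matter in the limit. *)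
Lemma cvg_prod_pm_steps (R : realType) (h : R^nat) (c : nat -> nat -> R)
    (n : nat -> nat) (t b : R) :
  (forall m, 0 < h m) -> h @ \oo --> 0 ->
  (\forall m \near \oo, c m 0%N = 0 /\ forall k, `|c m k.+1 - c m k| = h m) ->
  (n m)%:R * h m ^+ 2 @[m --> \oo] --> t ->
  c m (n m) @[m --> \oo] --> b ->
  \prod_(1 <= k < (n m).+1) (1 + c m k - c m k.-1) @[m --> \oo]
    --> expR (b - t / 2).
Proof.
move=> h0 hcvg hc nt cb.
have hNcvg : - h m @[m --> \oo] --> 0 by rewrite -[0]oppr0; exact: cvgN.
have h2cvg : - h m ^+ 2 @[m --> \oo] --> 0.
  rewrite -[0]oppr0; apply: cvgN; rewrite -(mulr0 0).
  by under eq_fun do rewrite expr2; exact: cvgM.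
have hn0 m : h m != 0 by rewrite gt_eqF.
have l1 := cvg_ln1D_div hcvg hn0.
have l2 : ln (1 - h m) / - h m @[m --> \oo] --> (1 : R).
  by apply: cvg_ln1D_div hNcvg _ => m; rewrite oppr_eq0.
have l3 : ln (1 - h m ^+ 2) / - h m ^+ 2 @[m --> \oo] --> (1 : R).
  by apply: cvg_ln1D_div h2cvg _ => m; rewrite oppr_eq0 expf_neq0.
have lim : expR
    (- ((n m)%:R * h m ^+ 2 * (ln (1 - h m ^+ 2) / - h m ^+ 2)) / 2 +
     c m (n m) * ((ln (1 + h m) / h m + ln (1 - h m) / - h m) / 2)) @[m --> \oo]
    --> expR (b - t / 2).
  apply: continuous_cvg; first exact: continuous_expR.
  have -> : b - t / 2 = - (t * 1) / 2 + b * ((1 + 1) / 2) by field.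
  apply: cvgD; apply: cvgM => //; last by apply: cvgM (cvg_cst _); exact: cvgD.
    by apply: cvgN; exact: cvgM.
  exact: cvg_cst.
apply: cvg_trans lim; apply: near_eq_cvg.
have h1 : \forall m \near \oo, h m < 1 by exact: (cvgr_lt _ hcvg).
near=> m.
have [c0 ch] : c m 0%N = 0 /\ forall k, `|c m k.+1 - c m k| = h m by near: m.
rewrite (prod_pm_steps _ _ c0 ch)// h0/=.
by near: m.
Unshelve. all: by end_near. Qed.

(** Equality of finite-dimensional distributions, applied to the complement of
    [A], transports null events, hence almost sure properties of finitely many
    coordinates. *)
Lemma same_fdd_ae (R : realType) (d d' : measure_display)
    (Omega : measurableType d) (Omega' : measurableType d')
    (P : probability Omega R) (P' : probability Omega' R)
    (I : Type) (X : I -> Omega -> R) (Y : I -> Omega' -> R)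
    (n : nat) (i : 'I_n -> I) (A : set (n.-tuple R)) :
  same_fdd P P' X Y -> (forall i, measurable_fun setT (X i)) ->
  (forall i, measurable_fun setT (Y i)) -> measurable A ->
  {ae P', forall w, A [tuple Y (i j) w | j < n]} ->
  {ae P, forall w, A [tuple X (i j) w | j < n]}.
Proof.
move=> XY mX mY mA AY; have mCA := measurableC mA.
have mpre d0 (O : measurableType d0) (Z : I -> O -> R) :
    (forall i, measurable_fun setT (Z i)) ->
    measurable ((fun w => [tuple Z (i j) w | j < n]) @^-1` (~` A)).
  move=> mZ; rewrite -[X in measurable X]setTI.
  suff : measurable_fun setT (fun w => [tuple Z (i j) w | j < n]) by exact.
  apply/measurable_fun_tnthP => j; rewrite (_ : _ \o _ = Z (i j))//.
  by apply/funext => w /=; rewrite tnth_mktuple.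
apply/negligibleP; first exact: (mpre _ _ _ mX).
apply: etrans (XY n i _ mCA) _.
by apply/measure_negligible => //; exact: (mpre _ _ _ mY).
Qed.

Lemma random_walk_step (R : realType) (d : measure_display)
    (Omega : measurableType d) (P : probability Omega R)
    (S : nat -> {RV P >-> R}) :
  simple_symmetric_random_walk S ->
  (forall w, S 0%N w = 0) /\
  forall k, {ae P, forall w, `|S k.+1 w - S k w| = 1}.
Proof.
move=> [r [_ rP SE]]; split=> [w|k]; first by rewrite SE big_ord0.
have m1 (a : R) : measurable (r k @^-1` [set a]).
  by rewrite -[X in measurable X]setTI; exact: measurable_funP.
have [P1 PN1] := rP k.
have mU := measurableU _ _ (m1 1) (m1 (-1)).
exists (~` (r k @^-1` [set 1] `|` r k @^-1` [set -1])); split.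
- exact: measurableC.
- rewrite probability_setC//; rewrite -[RHS](@subee _ 1%E)//; congr (_ - _)%E.
  rewrite measureU//; last first.
    apply/seteqP; split=> // w [/= -> /eqP]; rewrite -subr_eq0 opprK.
    by rewrite -[1 + 1]/(2%:R) pnatr_eq0.
  transitivity ((2^-1)%:E + (2^-1)%:E : \bar R)%E; first by congr (_ + _)%E.
  by rewrite -EFinD; congr EFin; field.
- move=> w /=; apply: contra_not.
  rewrite !SE big_ord_recr/= addrAC subrr add0r.
  by case=> ->; rewrite ?normrN normr1.
Qed.

(** Starting at [0] and moving by [h] are properties of at most two
    coordinates each, so they pass from the scaled walk to any process with
    the same finite-dimensional distributions. *)
Lemma scaled_walk_step (R : realType) (d d' : measure_display)
    (Omega : measurableType d) (Omega' : measurableType d')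
    (P : probability Omega R) (P' : probability Omega' R)
    (X : nat -> {RV P >-> R}) (S : nat -> {RV P' >-> R}) (h : R) :
  0 <= h -> simple_symmetric_random_walk S ->
  same_fdd P P' (fun k w => X k w) (fun k w => h * S k w) ->
  {ae P, forall w, X 0%N w = 0 /\ forall k, `|X k.+1 w - X k w| = h}.
Proof.
move=> h0 /random_walk_step[S0 Sstep] XS.
have mX k : measurable_fun setT (fun w => X k w) by exact: measurable_funP.
have mS k : measurable_fun setT (fun w => h * S k w).
  by apply: measurable_funM => //; exact: measurable_funP.
have mA n (f : n.-tuple R -> R) (a : R) :
    measurable_fun setT f -> measurable [set v | f v = a].
  move=> mf; rewrite -[X in measurable X]setTI.
  exact: (mf _ [set a]).
have X0 : {ae P, forall w, X 0%N w = 0}.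
  have := same_fdd_ae (i := fun _ : 'I_1 => 0%N) XS mX mS
    (mA _ _ 0 (measurable_tnth ord0)).
  move=> /(_ (aeW _ _)) XS0; apply: filterS (XS0 _) => [w|w] /=.
    by rewrite tnth_mktuple.
  by rewrite tnth_mktuple S0 mulr0.
have Xstep k : {ae P, forall w, `|X k.+1 w - X k w| = h}.
  pose f (v : 2.-tuple R) := `|tnth v ord_max - tnth v ord0|.
  have mf : measurable_fun setT f.
    apply: measurableT_comp => //.
    by apply: measurable_funB; exact: measurable_tnth.
  have XSk := same_fdd_ae (i := fun j : 'I_2 => (k + j)%N) XS mX mS
    (mA _ f h mf).
  apply: filterS (XSk _) => [w|]; rewrite /f /=.
    by rewrite !tnth_mktuple /= addn1 addn0.
  apply: filterS (Sstep k) => w /=.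
  rewrite !tnth_mktuple /= addn1 addn0 -mulrBr normrM => ->.
  by rewrite mulr1 ger0_norm.
by apply: filterS2 X0 (ae_foralln Xstep) => w; split.
Qed.

Lemma dist_interpolate (R : realType) (m : nat) (x : R -> R) (t h : R) :
  0 <= t -> (forall k, `|x (grid R m k.+1) - x (grid R m k)| <= h) ->
  `|interpolate m x t - x (grid R m (nsteps m t))| <= h.
Proof.
move=> t0 xh; rewrite /interpolate addrAC subrr add0r normrM.
have /truncn_itv/andP[] : 0 <= t * 2 ^+ (2 * m) by rewrite mulr_ge0 ?exprn_ge0.
rewrite -/(nsteps m t) -[(nsteps m t).+1%:R]natr1 => kt tk.
rewrite -[leRHS]mul1r; apply: ler_pM => //.
rewrite ger0_norm ?subr_ge0//.
by rewrite lerBlDl ltW.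
Qed.

(** Rounding down to the grid loses less than one cell, of length [4 ^- m]. *)
Lemma cvg_nsteps_grid (R : realType) (t : R) : 0 <= t ->
  (nsteps m t)%:R * (2 ^- m) ^+ 2 @[m --> \oo] --> t.
Proof.
move=> t0.
have q0 : (4^-1 : R) ^+ m @[m --> \oo] --> 0.
  by apply: cvg_expr; rewrite ger0_norm ?invr_ge0// invf_lt1//; lra.
apply: (@squeeze_cvgr _ _ _ _ (fun m => t - 4^-1 ^+ m) (cst t)).
- near=> m.
  have e : (2 ^+ (2 * m) : R) * 4^-1 ^+ m = 1.
    rewrite exprM exprVn (_ : 2 ^+ 2 = 4); last by rewrite expr2; ring.
    by rewrite mulfV// expf_neq0.
  have -> : ((2 ^- m) ^+ 2 : R) = 4^-1 ^+ m.
    rewrite -exprVn -exprM mulnC exprM exprVn.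
    by congr (_^-1 ^+ _); rewrite expr2; ring.
  have q1 : 0 < (4^-1 : R) ^+ m by rewrite exprn_gt0// invr_gt0.
  have /truncn_itv/andP[] : 0 <= t * 2 ^+ (2 * m)
    by rewrite mulr_ge0 ?exprn_ge0.
  rewrite -/(nsteps m t) -[(nsteps m t).+1%:R]natr1.
  move=> /(ler_wpM2r (ltW q1)) + /ltW/(ler_wpM2r (ltW q1)).
  by rewrite -mulrA e mulr1 mulrDl mul1r lerBlDr => -> ->.
- by rewrite -[X in _ --> X]subr0; apply: cvgB => //; exact: cvg_cst.
- exact: cvg_cst.
Unshelve. all: by end_near. Qed.

Theorem theorem10 (R : realType) (d : measure_display)
    (Omega : measurableType d) (P : probability Omega R)
    (B : R -> {RV P >-> R}) (W : nat -> R -> {RV P >-> R})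
    (* (a) *)
    (d' : measure_display) (Omega' : measurableType d')
    (P' : probability Omega' R) (S : nat -> {RV P' >-> R})
    (hS : simple_symmetric_random_walk S)
    (ha : forall m : nat, (1 <= m)%N ->
      same_fdd P P' (fun k w => W m (grid R m k) w)
                    (fun k w => 2 ^- m * S k w))
    (* (b) *)
    (hb : forall m : nat, (1 <= m)%N ->
      exists tau : nat -> {RV P >-> R},
        {ae P, forall w, partition_halfline (fun k => tau k w) /\
          forall k, (1 <= k)%N -> W m.+1 (tau k w) w = W m (grid R m k) w})
    (* (c) *)
    (hB : standard_brownian_motion B)
    (hc : forall T : R, 0 < T -> {ae P, forall w,
      ereal_sup [set `|B t w - interpolate m (fun s => W m s w) t|%:E
                | t in `[0, T]] @[m --> \oo] --> 0%E})
    (* (d) *)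
    (hd : exists tau : R -> R -> nat -> nat -> {RV P >-> R},
      {ae P, forall w, forall T T' : R, 0 < T -> T < T' ->
        let p := fun m k => tau T T' m k w in
        [/\ \forall m \near \oo,
              partition_upto T' (nsteps m T) (p m) /\
              forall k, (k <= nsteps m T)%N -> B (p m k) w = W m (grid R m k) w,
            \big[Num.max/0]_(1 <= k < (nsteps m T).+1) `|p m k - p m k.-1|
              @[m --> \oo] --> (0 : R)
          & \big[Num.max/0]_(0 <= k < (nsteps m T).+1) `|p m k - grid R m k|
              @[m --> \oo] --> (0 : R)]})
    (T : R) (hT : 0 < T) :
  {ae P, forall w, forall t : R, 0 <= t -> t <= T ->
    \prod_(1 <= k < (nsteps m t).+1)
        (1 + W m (grid R m k) w - W m (grid R m k.-1) w)
      @[m --> \oo] --> expR (B t w - t / 2)}.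
Proof.
have hpow : (2 ^- m : R) @[m --> \oo] --> 0.
  under eq_fun do rewrite -exprVn.
  by apply: cvg_expr; rewrite ger0_norm ?invr_ge0// invf_lt1//; lra.
have Wstep : {ae P, forall w m, (1 <= m)%N -> W m (grid R m 0) w = 0 /\
    forall k, `|W m (grid R m k.+1) w - W m (grid R m k) w| = 2 ^- m}.
  apply: ae_foralln => m; have [m1|_] := leqP 1 m; last exact: aeW.
  have h0 : 0 <= 2 ^- m :> R by rewrite invr_ge0 exprn_ge0.
  have := scaled_walk_step (X := fun k => W m (grid R m k)) h0 hS (ha m m1).
  by apply: filterS => w.
apply: filterS2 Wstep (hc T hT) => w Ww supw t t0 tT.
apply: (@cvg_prod_pm_steps _ (fun m => 2 ^- m) (fun m k => W m (grid R m k) w)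
  (fun m => nsteps m t)) => //.
- by near=> m; apply: Ww; near: m; exists 1%N.
- exact: cvg_nsteps_grid.
pose z m := interpolate m (fun s => W m s w) t.
have zB : z m @[m --> \oo] --> B t w.
  have : `|B t w - z m|%:E @[m --> \oo] --> 0%E.
    apply: squeeze_cvge supw; last exact: cvg_cst.
    near=> m; rewrite lee_fin normr_ge0/=; apply: ereal_sup_ubound.
    by exists t => //=; rewrite in_itv/= t0.
  move=> /fine_cvgP[_ /norm_cvg0 Bz0].
  rewrite -[B t w]subr0 -[z]/(fun m => z m).
  under [z in z @ _]eq_fun => m do rewrite -(subKr (B t w) (z m)).
  by apply: cvgB => //; exact: cvg_cst.
have zW : z m - W m (grid R m (nsteps m t)) w @[m --> \oo] --> 0.
  apply: norm_cvg0; apply: squeeze_cvgr hpow; last exact: cvg_cst.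
  near=> m; have m1 : (1 <= m)%N by near: m; exists 1%N.
  rewrite normr_ge0/=.
  apply: (dist_interpolate (x := fun s => W m s w)) => // k.
  by have [_ ->] := Ww m m1.
rewrite -[B t w]subr0.
under [z in z @ _]eq_fun => m do rewrite -(subKr (z m) (W m _ w)).
exact: cvgB.
Unshelve. all: by end_near. Qed.
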